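(* Let $A\in\mathbb{R}^{m\times n}$, $y\in\mathbb{R}^m$, let $k\ge 1$ be an integer and let $q$ be an integer with $2k\le q\le n$. Let $x^*\in\mathbb{R}^n$ be a (global) solution of $$\min_{x\in\mathbb{R}^n}\left\{\tfrac12\|y-Ax\|_2^2 : \|x\|_0\le k\right\},$$ and let $\eta:=y-Ax^*$. Suppose the restricted isometry constant of $A$ satisfies $$\delta_{3k}<\frac{1}{3\left(\frac{\sqrt5+1}{2}\right)^2\left(\left\lceil \frac{q}{k}\right\rceil+1\right)+1}.$$ Then the sequence $\{x^p\}_{p\ge 0}$ generated by the PGROTP algorithm satisfies, for all $p\ge 0$, $$\|x^{p+1}-x^*\|_2\le (\rho^* )^p\|x^0-x^*\|_2+\frac{\tau^*}{1-\rho^*}\|\eta\|_2,$$ where $$\rho^*:=\left(\frac{\sqrt5+1}{2}\right)^2\frac{3\left(\left\lceil \frac{q}{k}\right\rceil+1\right)\delta_{3k}}{1-\delta_{3k}}<1$$ (the inequality $\rho^*<1$ being guaranteed by the condition on $\delta_{3k}$) and $$\tau^*:=\frac{3\left(\frac{\sqrt5+1}{2}\right)^2\left(\left\lceil \frac{q}{k}\right\rceil+1\right)(1+\delta_k)+\sqrt5+1}{(1-\delta_{2k})\sqrt{1+\delta_{2k}}}+\frac{\sqrt{1+\delta_k}}{1-\delta_{2k}}.$$ In particular, when $\eta=0$, the sequence $\{x^p\}$ generated by PGROTP converges to $x^*$.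
   Context: $\|x\|_0$ is the number of nonzero entries of $x$; $x$ is $s$-sparse if $\|x\|_0\le s$; $\operatorname{supp}(x)$ is the set of indices of nonzero entries of $x$. $\lceil\cdot\rceil$ is the ceiling function, $\mathbf{e}\in\mathbb{R}^n$ is the vector of ones, $\otimes$ is the entrywise (Hadamard) product of vectors, and vector inequalities are entrywise. Restricted isometry constant: for an integer $s>0$, $\delta_s$ is the smallest number $\delta_s\ge 0$ such that $(1-\delta_s)\|x\|_2^2\le\|Ax\|_2^2\le(1+\delta_s)\|x\|_2^2$ for all $s$-sparse $x\in\mathbb{R}^n$. Hard thresholding: for an integer $r$, $\mathcal{H}_r(z)$ retains the $r$ entries of $z$ of largest magnitude and sets all other entries to zero (ties broken arbitrarily); $\mathcal{L}_r(z)$ denotes the support of $\mathcal{H}_r(z)$. PGROTP algorithm (partial gradient relaxed optimal $k$-thresholding pursuit), with inputs $A,y,k,q$: start from $x^0=0$ and for $p=0,1,2,\dots$ set $u^p=x^p+\mathcal{H}_q\left(A^T(y-Ax^p)\right)$; $\overline{w}^p\in\arg\min_w\{\|y-A(w\otimes u^p)\|_2^2:\ \mathbf{e}^Tw=k,\ 0\le w\le\mathbf{e}\}$ (any minimizer); $S^{p+1}=\mathcal{L}_k(\overline{w}^p\otimes u^p)$; $x^{p+1}=\arg\min_z\{\|y-Az\|_2:\ \operatorname{supp}(z)\subseteq S^{p+1}\}$. *)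

(* Defs.v *)
From HB Require Import structures.
From mathcomp Require Import all_boot all_order all_algebra.
From mathcomp Require Import all_classical all_reals all_analysis.
Set Implicit Arguments.
Unset Strict Implicit.
Unset Printing Implicit Defensive.
Import Order.TTheory GRing.Theory Num.Theory.
Import numFieldNormedType.Exports.
Local Open Scope classical_set_scope.
Local Open Scope ring_scope.

Section Definitions.
Variable R : realType.

(* The norm that MathComp-Analysis puts on matrices is the sup norm. *)
Definition l2norm n (x : 'cV[R]_n) : R := Num.sqrt (\sum_i x i 0 ^+ 2).

Definition vsupp n (x : 'cV[R]_n) : {set 'I_n} := [set i | x i 0 != 0]%SET.

Definition sparse n (s : nat) (x : 'cV[R]_n) : bool := (#|vsupp x| <= s)%N.

Definition hadamard n (w u : 'cV[R]_n) : 'cV[R]_n := map2_mx *%R w u.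

Definition is_argmin T (P : T -> Prop) (f : T -> R) (x : T) : Prop :=
  P x /\ forall z, P z -> f x <= f z.

Definition rip_bound m n (A : 'M[R]_(m, n)) (s : nat) (d : R) : Prop :=
  0 <= d /\ forall x : 'cV[R]_n, sparse s x ->
    (1 - d) * l2norm x ^+ 2 <= l2norm (A *m x) ^+ 2 <= (1 + d) * l2norm x ^+ 2.

(* The infimum is attained, see [ric_smallest] below. *)
Definition ric m n (A : 'M[R]_(m, n)) (s : nat) : R :=
  inf [set d | rip_bound A s d].

(* Ties may be broken arbitrarily, so hard thresholding is a relation: [h] is
   obtained from [z] by keeping the entries indexed by some [T] that collects
   [r] entries of largest magnitude. It is meaningful for [r <= n]. *)
Definition hard_threshold n (r : nat) (z h : 'cV[R]_n) : Prop :=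
  exists T : {set 'I_n},
    [/\ #|T| = r,
        forall i j, i \in T -> j \notin T -> `|z j 0| <= `|z i 0| &
        h = \col_i (if i \in T then z i 0 else 0)].

(* [S] is the support of the thresholded vector, so [#|S| < r] when [z] has
   fewer than [r] nonzero entries. *)
Definition hard_support n (r : nat) (z : 'cV[R]_n) (S : {set 'I_n}) : Prop :=
  exists2 h, hard_threshold r z h & S = vsupp h.

Definition pgrotp_step m n (A : 'M[R]_(m, n)) (y : 'cV[R]_m) (k q : nat)
    (x x' : 'cV[R]_n) : Prop :=
  exists (h u w : 'cV[R]_n) (S : {set 'I_n}),
    [/\ hard_threshold q (A^T *m (y - A *m x)) h,
        u = x + h,
        is_argmin
          (fun w : 'cV[R]_n =>
             \sum_i w i 0 = k%:R /\ forall i, 0 <= w i 0 <= 1)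
          (fun w => l2norm (y - A *m hadamard w u) ^+ 2) w,
        hard_support k (hadamard w u) S &
        is_argmin (fun z : 'cV[R]_n => vsupp z \subset S)
          (fun z => l2norm (y - A *m z)) x'].

(* Since the choices made by the algorithm need not be unique, this describes
   any sequence that it may generate. *)
Definition pgrotp m n (A : 'M[R]_(m, n)) (y : 'cV[R]_m) (k q : nat)
    (x : nat -> 'cV[R]_n) : Prop :=
  x 0%N = 0 /\ forall p, pgrotp_step A y k q (x p) (x p.+1).

Lemma l2norm_sqr n (x : 'cV[R]_n) : l2norm x ^+ 2 = \sum_i x i 0 ^+ 2.
Proof. by rewrite sqr_sqrtr // sumr_ge0 // => i _; exact: sqr_ge0. Qed.

Lemma rip_bound_nonempty m n (A : 'M[R]_(m, n)) s :
  [set d | rip_bound A s d] !=set0.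
Proof.
pose c := \sum_i (\sum_j `|A i j|) ^+ 2.
have c0 : 0 <= c by apply: sumr_ge0 => i _; exact: sqr_ge0.
exists (1 + c); split; first by rewrite addr_ge0.
move=> x _; apply/andP; split.
  apply: (@le_trans _ _ 0); last exact: sqr_ge0.
  by rewrite opprD addNKr mulNr oppr_le0 mulr_ge0 // sqr_ge0.
have xj j : `|x j 0| <= l2norm x.
  rewrite -sqrtr_sqr ler_wsqrtr // (bigD1 j) //= lerDl.
  by apply: sumr_ge0 => i _; exact: sqr_ge0.
apply: (@le_trans _ _ (c * l2norm x ^+ 2)); last first.
  by rewrite ler_wpM2r ?sqr_ge0 // addrA lerDr.
rewrite l2norm_sqr /c mulr_suml; apply: ler_sum => i _.
rewrite -exprMn -real_normK ?num_real // lerXn2r ?nnegrE //.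
  by rewrite mulr_ge0 ?sqrtr_ge0 // sumr_ge0.
rewrite mxE (le_trans (ler_norm_sum _ _ _)) // mulr_suml.
by apply: ler_sum => j _; rewrite normrM ler_wpM2l.
Qed.

Lemma ric_smallest m n (A : 'M[R]_(m, n)) s :
  is_argmin (rip_bound A s) id (ric A s).
Proof.
have lb0 : lbound [set d | rip_bound A s d] 0 by move=> d [].
have hi : has_inf [set d | rip_bound A s d].
  by split; [exact: rip_bound_nonempty | exists 0].
have near e : 0 < e -> exists2 d, rip_bound A s d & d < ric A s + e.
  by move=> e0; have [d ? ?] := inf_adherent e0 hi; exists d.
split; last by move=> d Hd; apply: ge_inf => //; exists 0.
split; first by apply: lb_le_inf => //; exact: rip_bound_nonempty.
move=> x sx; have [x0|x0] := eqVneq (l2norm x ^+ 2) 0.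
  have [d [_ /(_ x sx)]] := rip_bound_nonempty A s.
  by rewrite x0 !mulr0.
have {}x0 : 0 < l2norm x ^+ 2 by rewrite lt_def x0 sqr_ge0.
apply/andP; split; apply/ler_addgt0Pr => e e0;
  have [d [_ /(_ x sx) /andP[h1 h2]] dl] := near _ (divr_gt0 e0 x0).
  rewrite -lerBlDr; apply: le_trans h1.
  rewrite -[in leLHS](divfK (lt0r_neq0 x0) e) -mulrBl ler_wpM2r ?(ltW x0) //.
  by rewrite -addrA -opprD lerD2l lerN2 ltW.
apply: (le_trans h2); rewrite -[in leRHS](divfK (lt0r_neq0 x0) e) -mulrDl.
by rewrite ler_wpM2r ?(ltW x0) // -addrA lerD2l ltW.
Qed.

End Definitions.

(* Main.v *)
(* Write B = delta_3k |x_p - xs| + sqrt (1 + delta_k) |eta|. On a block of at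
   most k coordinates the residual gradient A^T (y - A x_p) approximates
   xs - x_p up to B, by the RIP. Hard thresholding of that gradient then gives
   |xs - u| <= phi sqrt (N + 1) B with N = ceil (q / k) + 1 and phi the golden
   ratio. Compare the relaxed minimizer w with the indicator of a k-set that
   contains the support of xs, and cut z = hadamard w u, which is supported on
   N blocks, into its k largest entries and the rest: this bounds xs - z on the
   support of xs and those k entries by a multiple of |xs - u|. A second
   thresholding estimate and the least squares step give a linear contraction.
   Summing blocks by Pythagoras yields (1 + sqrt N) sqrt (N + 1), which the
   factor 3 N of the theorem dominates. *)
Require Import Defs.
From HB Require Import structures.
From mathcomp Require Import all_boot all_order all_algebra.
From mathcomp Require Import all_classical all_reals all_analysis.
From mathcomp Require Import zify ring lra.
Set Implicit Arguments.
Unset Strict Implicit.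
Unset Printing Implicit Defensive.
Import Order.TTheory GRing.Theory Num.Theory.
Import numFieldNormedType.Exports.
Local Open Scope classical_set_scope.
Local Open Scope ring_scope.

(** * Inner products, restrictions and supports of vectors *)

Section Euclidean.
Variable R : realType.

Definition dot n (x y : 'cV[R]_n) : R := (x^T *m y) 0 0.

(** Has the same body as the vector in [hard_threshold], so a thresholded vector is convertible to
    [restr T z]. *)
Definition restr n (U : {set 'I_n}) (x : 'cV[R]_n) : 'cV[R]_n :=
  \col_i (if i \in U then x i 0 else 0).

Section Dot.
Variable n : nat.
Implicit Types (x y z : 'cV[R]_n) (U V : {set 'I_n}).

Lemma dotE x y : dot x y = \sum_i x i 0 * y i 0.
Proof. by rewrite /dot mxE; apply: eq_bigr => i _; rewrite mxE. Qed.

Lemma dotC x y : dot x y = dot y x.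
Proof. by rewrite !dotE; apply: eq_bigr => i _; rewrite mulrC. Qed.

Lemma dotDr x y z : dot x (y + z) = dot x y + dot x z.
Proof. by rewrite /dot mulmxDr mxE. Qed.

Lemma dotDl x y z : dot (y + z) x = dot y x + dot z x.
Proof. by rewrite dotC dotDr !(dotC x). Qed.

Lemma dotZr a x y : dot x (a *: y) = a * dot x y.
Proof. by rewrite /dot -scalemxAr mxE. Qed.

Lemma dotZl a x y : dot (a *: y) x = a * dot y x.
Proof. by rewrite dotC dotZr dotC. Qed.

Lemma dotNr x y : dot x (- y) = - dot x y.
Proof. by rewrite -scaleN1r dotZr mulN1r. Qed.

Lemma dotNl x y : dot (- y) x = - dot y x.
Proof. by rewrite dotC dotNr dotC. Qed.

Lemma dotxx x : dot x x = l2norm x ^+ 2.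
Proof. by rewrite dotE l2norm_sqr; apply: eq_bigr => i _; rewrite expr2. Qed.

Lemma l2norm_ge0 x : 0 <= l2norm x.
Proof. exact: sqrtr_ge0. Qed.

Lemma l2norm_coord x i : `|x i 0| <= l2norm x.
Proof.
rewrite -sqrtr_sqr ler_wsqrtr // (bigD1 i) //= lerDl.
by apply: sumr_ge0 => j _; exact: sqr_ge0.
Qed.

Lemma l2norm0_eq0 x : l2norm x = 0 -> x = 0.
Proof.
move=> x0; apply/colP => i; rewrite mxE; apply/eqP.
by rewrite -normr_le0 -x0 l2norm_coord.
Qed.

Lemma l2normN x : l2norm (- x) = l2norm x.
Proof. by rewrite /l2norm; under eq_bigr do rewrite mxE sqrrN. Qed.

Lemma l2norm0 : l2norm (0 : 'cV[R]_n) = 0.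
Proof.
by rewrite /l2norm big1 ?sqrtr0 // => i _; rewrite mxE expr0n.
Qed.

(** Cauchy-Schwarz: the squared norm of [l2norm y ^+ 2 *: x - dot x y *: y] expands to
    [b ^+ 2 * (a ^+ 2 * b ^+ 2 - d ^+ 2)], with [a], [b] the two norms and [d] the inner product. *)
Lemma dot_le x y : dot x y <= l2norm x * l2norm y.
Proof.
have [y0|y0] := eqVneq (l2norm y) 0.
  by rewrite y0 mulr0 (l2norm0_eq0 y0) /dot mulmx0 mxE.
have {}y0 : 0 < l2norm y by rewrite lt_def y0 l2norm_ge0.
have := sqr_ge0 (l2norm (l2norm y ^+ 2 *: x - dot x y *: y)).
rewrite -(dotxx (_ - _)) dotDl !dotDr !dotNl !dotNr !dotZl !dotZr !dotxx (dotC y x).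
move: y0; set a := l2norm x; set b := l2norm y; set d := dot x y => b0 h.
have a0 : 0 <= a := l2norm_ge0 x.
clearbody a b d => {x y}.
have hd : 0 <= (a ^+ 2 * b ^+ 2 - d ^+ 2) * b ^+ 2 by nra.
have {}hd : (d ^+ 2) * b ^+ 2 <= (a * b) ^+ 2 * b ^+ 2 by nra.
rewrite !ler_pM2r ?exprn_gt0 // in hd.
have [d0|d0] := leP d 0; first by rewrite (le_trans d0) // mulr_ge0 // ltW.
by rewrite -ler_sqr ?nnegrE ?mulr_ge0 // ltW.
Qed.

Lemma l2normD x y : l2norm (x + y) <= l2norm x + l2norm y.
Proof.
rewrite -ler_sqr ?nnegrE ?addr_ge0 ?l2norm_ge0 //.
rewrite -dotxx dotDl !dotDr !dotxx (dotC y x).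
by have := dot_le x y; nra.
Qed.

(** Serves to bound a restricted vector by pairing it with itself and cancelling one factor of its
    norm. *)
Lemma l2norm_le_of_dot x b : 0 <= b -> dot x x <= b * l2norm x -> l2norm x <= b.
Proof.
move=> b0; have [->//|x0] := eqVneq (l2norm x) 0.
by rewrite dotxx expr2 ler_pM2r // lt_def x0 l2norm_ge0.
Qed.

Lemma ler_l2norm x y : (forall i, `|x i 0| <= `|y i 0|) -> l2norm x <= l2norm y.
Proof.
move=> le_xy; rewrite ler_wsqrtr // ler_sum // => i _.
rewrite -(real_normK (num_real (x i 0))) -(real_normK (num_real (y i 0))).
by rewrite lerXn2r ?nnegrE.
Qed.

Lemma sparseS s x y : vsupp x \subset vsupp y -> sparse s y -> sparse s x.
Proof. by move=> /subset_leq_card; exact: leq_trans. Qed.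

Lemma sparse_sub s x U : vsupp x \subset U -> (#|U| <= s)%N -> sparse s x.
Proof. by move=> /subset_leq_card; exact: leq_trans. Qed.

Lemma vsuppPn x i : reflect (x i 0 = 0) (i \notin vsupp x).
Proof. by rewrite inE negbK; exact: eqP. Qed.

Lemma vsupp_subP x U :
  reflect (forall i, i \notin U -> x i 0 = 0) (vsupp x \subset U).
Proof.
apply: (iffP fintype.subsetP) => xU i; first by move=> iU; apply/vsuppPn/(contra (xU i)).
by apply: contraLR => /xU/vsuppPn.
Qed.

Lemma vsuppD x y : vsupp (x + y) \subset vsupp x :|: vsupp y.
Proof.
apply/vsupp_subP => i; rewrite inE negb_or => /andP[/vsuppPn xi /vsuppPn yi].
by rewrite mxE xi yi addr0.
Qed.

Lemma vsuppN x : vsupp (- x) = vsupp x.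
Proof. by apply/setP => i; rewrite !inE mxE oppr_eq0. Qed.

Lemma vsupp_restr U x : vsupp (restr U x) \subset U.
Proof. by apply/vsupp_subP => i /negbTE iU; rewrite mxE iU. Qed.

Lemma restrD U x y : restr U (x + y) = restr U x + restr U y.
Proof. by apply/colP => i; rewrite !mxE; case: ifP; rewrite ?addr0. Qed.

Lemma restrN U x : restr U (- x) = - restr U x.
Proof. by apply/colP => i; rewrite !mxE; case: ifP; rewrite ?oppr0. Qed.

Lemma restr_id U x : vsupp x \subset U -> restr U x = x.
Proof.
by move=> /vsupp_subP xU; apply/colP => i; rewrite mxE; case: ifPn => // /xU.
Qed.

Lemma restr_addC U x : restr U x + restr (~: U) x = x.
Proof. by apply/colP => i; rewrite !mxE inE; case: ifP; rewrite ?addr0 ?add0r. Qed.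

Lemma l2norm_restr U x : l2norm (restr U x) ^+ 2 = \sum_(i in U) x i 0 ^+ 2.
Proof.
rewrite l2norm_sqr [RHS]big_mkcond; apply: eq_bigr => i _; rewrite mxE.
by case: ifP => // _; rewrite expr0n.
Qed.

Lemma l2norm_restr_le U x : l2norm (restr U x) <= l2norm x.
Proof. by apply: ler_l2norm => i; rewrite mxE; case: ifP; rewrite ?normr0. Qed.

Lemma l2norm_restrD U V x : V \subset U ->
  l2norm (restr U x) ^+ 2 =
  l2norm (restr V x) ^+ 2 + l2norm (restr (U :\: V) x) ^+ 2.
Proof.
move=> VU; rewrite !l2norm_restr (big_setID V) /=; congr (_ + _).
by rewrite (finset.setIidPr VU).
Qed.

Lemma l2norm_restrC U x :
  l2norm x ^+ 2 = l2norm (restr U x) ^+ 2 + l2norm (restr (~: U) x) ^+ 2.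
Proof.
by rewrite -finset.setTD -l2norm_restrD ?finset.subsetT // restr_id ?finset.subsetT.
Qed.

Lemma dot_restrl U x y : vsupp x \subset U -> dot x (restr U y) = dot x y.
Proof.
move=> /vsupp_subP xU; rewrite !dotE; apply: eq_bigr => i _; rewrite mxE.
by case: ifPn => // /xU ->; rewrite !mul0r.
Qed.

End Dot.

Lemma dot_mulmx m n (A : 'M[R]_(m, n)) x y : dot (A *m x) y = dot x (A^T *m y).
Proof. by rewrite /dot trmx_mul mulmxA. Qed.

Lemma subset_of_card (T : finType) (U : {set T}) s : (s <= #|U|)%N ->
  exists2 V : {set T}, V \subset U & #|V| = s.
Proof.
case/card_geqP => l [ul sl lU]; exists [set x in l]%SET.
  by apply/fintype.subsetP => x; rewrite inE => /lU.
by rewrite cardsE (card_uniqP ul).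
Qed.

Lemma superset_of_card (T : finType) (U : {set T}) s :
  (#|U| <= s <= #|T|)%N -> exists2 V : {set T}, U \subset V & #|V| = s.
Proof.
case/andP => Us sT.
have [|V VU cV] := @subset_of_card _ (~: U) (s - #|U|).
  by have := cardsC U; lia.
exists (U :|: V); first exact: finset.subsetUl.
rewrite cardsU disjoint_setI0 ?cards0 ?subn0 ?cV ?subnKC //.
by rewrite disjoint_sym finset.disjoints_subset.
Qed.

Lemma split_block (T : finType) (U : {set T}) k N : (#|U| <= N.+1 * k)%N ->
  exists V : {set T}, [/\ V \subset U, (#|V| <= k)%N & (#|U :\: V| <= N * k)%N].
Proof.
move=> Uk; have [V VU cV] := subset_of_card (geq_minl #|U| k).
exists V; split=> //; first by rewrite cV geq_minr.
by rewrite cardsD (finset.setIidPr VU) cV; lia.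
Qed.

End Euclidean.

(** * Consequences of the restricted isometry property *)

Section RestrictedIsometry.
Variable R : realType.
Variables m n : nat.
Implicit Types (A : 'M[R]_(m, n)) (x v w : 'cV[R]_n) (U V : {set 'I_n}).

Lemma rip_boundS A s s' d : (s' <= s)%N -> rip_bound A s d -> rip_bound A s' d.
Proof. by move=> ss' [d0 rip]; split=> // x xs; apply/rip/(leq_trans xs). Qed.

Lemma rip_ric A s : rip_bound A s (ric A s).
Proof. by case: (ric_smallest A s). Qed.

Lemma ric_le A s s' : (s' <= s)%N -> ric A s' <= ric A s.
Proof.
by move=> ss'; apply: (ric_smallest A s').2; exact: rip_boundS (rip_ric A s).
Qed.

Lemma rip_ub A s d x : rip_bound A s d -> sparse s x ->
  l2norm (A *m x) <= Num.sqrt (1 + d) * l2norm x.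
Proof.
move=> [d0 rip] /rip/andP[_ h].
rewrite -ler_sqr ?nnegrE ?mulr_ge0 ?sqrtr_ge0 // exprMn (@sqr_sqrtr _ (1 + d)) //.
by rewrite addr_ge0.
Qed.

Lemma rip_lb A s d x : d <= 1 -> rip_bound A s d -> sparse s x ->
  Num.sqrt (1 - d) * l2norm x <= l2norm (A *m x).
Proof.
move=> d1 [d0 rip] /rip/andP[h _].
rewrite -ler_sqr ?nnegrE ?mulr_ge0 ?sqrtr_ge0 // exprMn (@sqr_sqrtr _ (1 - d)) //.
by rewrite subr_ge0.
Qed.

(* Polarization, applied to [v] and [w] scaled to equal norms. *)
Lemma rip_dot A s d v w U : rip_bound A s d ->
  vsupp v \subset U -> vsupp w \subset U -> (#|U| <= s)%N ->
  dot v w - dot (A *m v) (A *m w) <= d * (l2norm v * l2norm w).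
Proof.
move=> [d0 rip] vU wU Us.
have [v0|v0] := eqVneq (l2norm v) 0.
  by rewrite v0 (l2norm0_eq0 v0) mulmx0 /dot !trmx0 !mul0mx !mxE subr0 mul0r mulr0.
have [w0|w0] := eqVneq (l2norm w) 0.
  by rewrite w0 (l2norm0_eq0 w0) mulmx0 /dot !mulmx0 !mxE subr0 !mulr0.
have {}v0 : 0 < l2norm v by rewrite lt_def v0 l2norm_ge0.
have {}w0 : 0 < l2norm w by rewrite lt_def w0 l2norm_ge0.
set a := l2norm v in v0 *; set b := l2norm w in w0 *.
have comb e : sparse s (b *: v + e *: w).
  apply: (sparse_sub _ Us); apply/vsupp_subP => i iU.
  by rewrite !mxE (vsupp_subP _ _ vU) // (vsupp_subP _ _ wU) // !mulr0 addr0.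
have /rip/andP[_ h1] := comb (- a); have /rip/andP[h2 _] := comb a.
move: h1 h2; rewrite -!dotxx !mulmxDr -!scalemxAr !dotDl !dotDr !dotZl !dotZr.
rewrite !(dotC w v) !(dotC (A *m w) (A *m v)) !dotxx -/a -/b.
move: (dot v w) (dot _ _) (l2norm (A *m v)) (l2norm (A *m w)) => p r e f h1 h2.
have ab : 0 < a * b by rewrite mulr_gt0.
rewrite -(ler_pM2l ab); clearbody a b; nra.
Qed.

(** Pythagoras over disjoint blocks, peeled off one at a time; a uniform bound on blocks thus costs
    only a factor [sqrt N] on the norm. *)
Lemma l2norm_blocks k b v : 0 <= b ->
  (forall V, (#|V| <= k)%N -> l2norm (restr V v) <= b) ->
  forall N U, (#|U| <= N * k)%N -> l2norm (restr U v) ^+ 2 <= N%:R * b ^+ 2.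
Proof.
move=> b0 blk; elim=> [|N IHN] U Uk.
  rewrite mul0n leqn0 cards_eq0 in Uk; rewrite l2norm_restr (eqP Uk) big_set0.
  by rewrite mul0r.
have [V [VU Vk UVk]] := split_block Uk.
rewrite (l2norm_restrD _ VU) mulrS mulrDl mul1r lerD ?IHN //.
by rewrite lerXn2r ?nnegrE ?l2norm_ge0 ?blk.
Qed.

(** Only sparsity [k] is controlled, so [x] is cut into blocks and the images are added by the
    triangle inequality. The images need not be orthogonal, which is why the factor [N] appears. *)
Lemma rip_ub_blocks A k d N x : rip_bound A k d -> sparse (N * k) x ->
  l2norm (A *m x) ^+ 2 <= N%:R * (1 + d) * l2norm x ^+ 2.
Proof.
move=> rip; have d0 : 0 <= d by case: rip.
elim: N x => [|N IHN] x xk.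
  have -> : x = 0.
    move: xk; rewrite /sparse mul0n leqn0 cards_eq0 => /eqP x0.
    by apply/colP => i; rewrite mxE; apply/vsuppPn; rewrite x0 inE.
  by rewrite mulmx0 !l2norm0 expr0n mulr0.
have [V [VU Vk UVk]] := split_block xk.
have := @rip_ub A k d (restr V x) rip (sparse_sub (vsupp_restr V x) Vk).
rewrite -ler_sqr ?nnegrE ?mulr_ge0 ?sqrtr_ge0 // exprMn (@sqr_sqrtr _ (1 + d)) ?addr_ge0 //.
have := IHN _ (sparse_sub (vsupp_restr (vsupp x :\: V) x) UVk).
have := l2normD (A *m restr V x) (A *m restr (vsupp x :\: V) x).
rewrite -mulmxDr; have -> : restr V x + restr (vsupp x :\: V) x = x.
  apply/colP => i; rewrite !mxE !inE; case: ifP => /=; rewrite ?addr0 // => _.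
  by rewrite add0r; case: eqP.
have := l2norm_restrD x VU; rewrite (restr_id (fintype.subxx _)) => ->.
have := l2norm_ge0 (A *m x); have := l2norm_ge0 (A *m restr V x).
have := l2norm_ge0 (A *m restr (vsupp x :\: V) x).
move: (l2norm (A *m x)) (l2norm (A *m restr V x))
  (l2norm (A *m restr (vsupp x :\: V) x)).
move: (sqr_ge0 (l2norm (restr V x)))
  (sqr_ge0 (l2norm (restr (vsupp x :\: V) x))).
move: (_ ^+ 2) (_ ^+ 2) => Y X Y0 X0 r p s s0 p0 r0 rps sN pX.
have N0 : 0 <= N%:R :> R by [].
rewrite -natr1; move: (N%:R) N0 sN => M M0 sN.
have D0 : 0 < 1 + d by lra.
move: (1 + d) D0 pX sN => D D0 pX sN.
(* The cross term, by AM-GM from [p ^+ 2 <= D * X] and [s ^+ 2 <= M * D * Y]; with these weights the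
   total is exactly [(M + 1) * D * (X + Y)]. *)
have ps : p * s * 2 <= M * D * X + D * Y.
  rewrite -ler_sqr ?nnegrE ?addr_ge0 ?mulr_ge0 ?(ltW D0) //.
  have : p ^+ 2 * s ^+ 2 <= (D * X) * (M * D * Y).
    by apply: ler_pM; rewrite ?sqr_ge0.
  have := sqr_ge0 (M * D * X - D * Y); nra.
apply: (@le_trans _ _ ((p + s) ^+ 2)); last by nra.
by rewrite lerXn2r ?nnegrE ?addr_ge0.
Qed.

(** The restricted vector [r] is paired with itself. Together [r] and [v] occupy at most [3 * k]
    coordinates, so [rip_dot] gives the term in [d3]; in the noise term [A^T] is moved onto the
    [k]-sparse [r], hence [d1]. *)
Lemma rip_grad A k d1 d3 v (e : 'cV[R]_m) V :
  rip_bound A k d1 -> rip_bound A (3 * k) d3 ->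
  sparse (2 * k) v -> (#|V| <= k)%N ->
  l2norm (restr V (v - A^T *m (A *m v + e))) <=
    d3 * l2norm v + Num.sqrt (1 + d1) * l2norm e.
Proof.
move=> rip1 rip3 vk Vk; have d30 : 0 <= d3 by case: rip3.
set r := restr V _; have rV : vsupp r \subset V by exact: vsupp_restr.
apply: l2norm_le_of_dot; first by rewrite addr_ge0 ?mulr_ge0 ?sqrtr_ge0.
rewrite {2}/r dot_restrl // dotDr dotNr -dot_mulmx dotDr opprD addrA.
rewrite mulrDl lerD //.
  rewrite -mulrA [l2norm v * _]mulrC; apply: (rip_dot (U := V :|: vsupp v) rip3).
  - exact: fintype.subset_trans rV (finset.subsetUl _ _).
  - exact: finset.subsetUr.
  - by apply: leq_trans (leq_card_setU _ _) _; rewrite /sparse in vk; lia.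
rewrite -dotNr; apply: le_trans (dot_le _ _) _; rewrite l2normN mulrAC.
by rewrite ler_wpM2r ?l2norm_ge0 // (rip_ub rip1) // (sparse_sub rV).
Qed.

End RestrictedIsometry.

(** * Least squares on a fixed support *)

Section Pursuit.
Variable R : realType.

(** First-order optimality without derivatives: [t = p / (s + 1)] gives
    [2 * t ^+ 2 * (s + 1) <= t ^+ 2 * s], which forces [t = 0]. The shift by 1 keeps the denominator
    nonzero when [s = 0]. *)
Lemma linear_le_quadratic (p s : R) : 0 <= s ->
  (forall t, 2 * t * p <= t ^+ 2 * s) -> p = 0.
Proof.
move=> s0 /(_ (p / (s + 1))); have s1 : s + 1 != 0 by rewrite gt_eqF; lra.
rewrite -{2 4}(divfK s1 p); move: (p / _) => t h.
suff /eqP : t ^+ 2 = 0 by rewrite sqrf_eq0 => /eqP ->; rewrite mul0r.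
by apply/eqP; rewrite eq_le sqr_ge0 andbT; have := sqr_ge0 t; nra.
Qed.

(** Solves the quadratic inequality for [D]. After rescaling to [B = b / s] and [E = e / (1 - d)]
    the claim is [D <= B + E]. *)
Lemma pursuit_arith (d D e b : R) : 0 <= d < 1 -> 0 <= D -> 0 <= e -> 0 <= b ->
  D ^+ 2 <= (d * D + e) ^+ 2 + b ^+ 2 ->
  D <= b / Num.sqrt (1 - d ^+ 2) + e / (1 - d).
Proof.
move=> /andP[d0 d1] D0 e0 b0.
have s2 : 0 < 1 - d ^+ 2 by nra.
have s0 : 0 < Num.sqrt (1 - d ^+ 2) by rewrite sqrtr_gt0.
have := sqr_sqrtr (ltW s2); set s := Num.sqrt _ in s0 * => ss.
have d1' : 0 < 1 - d by lra.
have -> : (d * D + e) ^+ 2 + b ^+ 2 =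
    (d * D + (1 - d) * (e / (1 - d))) ^+ 2 + s ^+ 2 * (b / s) ^+ 2.
  by field; rewrite !gt_eqF.
have := divr_ge0 e0 (ltW d1'); have := divr_ge0 b0 (ltW s0).
rewrite ss; move: (b / s) (e / (1 - d)) => B E B0 E0.
apply: contraTT; rewrite -!ltNge => BED.
have h1 : (1 + d) * B < (1 + d) * D + (1 - d) * E by nra.
(* The right side factors [D ^+ 2 - (d * D + (1 - d) * E) ^+ 2], the left side is
   [s ^+ 2 * B ^+ 2]. *)
have : ((1 - d) * B) * ((1 + d) * B) <
    ((1 - d) * (D - E)) * ((1 + d) * D + (1 - d) * E).
  by apply: ltr_pM => //; nra.
nra.
Qed.

(** Off [S] the error is [- xs], since [x'] vanishes there. On [S] the normal equations and the RIP
    bound it by [d2] times the full error plus noise. Pythagoras joins both parts and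
    [pursuit_arith] isolates the full error. *)
Lemma pursuit_error m n (A : 'M[R]_(m, n)) y k d1 d2 xs x' (S : {set 'I_n}) :
  rip_bound A k d1 -> rip_bound A (2 * k) d2 -> d2 < 1 ->
  sparse k xs -> (#|S| <= k)%N ->
  is_argmin (fun z : 'cV[R]_n => vsupp z \subset S)
    (fun z => l2norm (y - A *m z)) x' ->
  l2norm (x' - xs) <= l2norm (restr (~: S) xs) / Num.sqrt (1 - d2 ^+ 2)
    + Num.sqrt (1 + d1) * l2norm (y - A *m xs) / (1 - d2).
Proof.
move=> rip1 rip2 d21 xsk Sk [x'S x'min]; have d20 : 0 <= d2 by case: rip2.
(* Normal equations, from comparing [x'] with [x' + t *: z] for every real [t]. *)
have normal z : vsupp z \subset S -> dot (A *m z) (y - A *m x') = 0.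
  move=> zS; apply: (linear_le_quadratic (sqr_ge0 (l2norm (A *m z)))) => t.
  have /x'min : vsupp (x' + t *: z) \subset S.
    apply/vsupp_subP => i iS.
    by rewrite !mxE (vsupp_subP _ _ x'S) // (vsupp_subP _ _ zS) // mulr0 addr0.
  rewrite -ler_sqr ?nnegrE ?l2norm_ge0 // mulmxDr opprD addrA -scalemxAr.
  rewrite -!dotxx; set r := y - _; clearbody r.
  rewrite (dotDl _ r) !dotDr !dotNl !dotNr !dotZl !dotZr.
  by rewrite (dotC r); nra.
set D := x' - xs.
have offS : restr (~: S) D = - restr (~: S) xs.
  rewrite restrD restrN [X in X + _](_ : _ = 0) ?add0r //; apply/colP => i.
  by rewrite !mxE inE; case: ifPn => // /(vsupp_subP _ _ x'S).
have DS : l2norm (restr S D) <=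
    d2 * l2norm D + Num.sqrt (1 + d1) * l2norm (y - A *m xs).
  have rS := vsupp_restr S D.
  apply: l2norm_le_of_dot; first by rewrite addr_ge0 ?mulr_ge0 ?sqrtr_ge0.
  rewrite dot_restrl // -[dot _ _](subrK (dot (A *m restr S D) (A *m D))).
  rewrite mulrDl lerD //.
    rewrite -mulrA [l2norm D * _]mulrC; apply: (rip_dot (U := S :|: vsupp xs) rip2).
    - exact: fintype.subset_trans rS (finset.subsetUl _ _).
    - rewrite (fintype.subset_trans (vsuppD _ _)) // vsuppN.
      by rewrite finset.setSU.
    - by apply: leq_trans (leq_card_setU _ _) _; rewrite /sparse in xsk; lia.
  (* The residual at [x'] is killed by [normal], so only the noise [y - A *m xs] survives. *)
  rewrite (_ : A *m D = (y - A *m xs) - (y - A *m x')); last first.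
    by rewrite mulmxBr opprB [RHS]addrC addrA subrK.
  rewrite dotDr dotNr normal // subr0; apply: le_trans (dot_le _ _) _.
  by rewrite mulrAC ler_wpM2r ?l2norm_ge0 // (rip_ub rip1) // (sparse_sub rS).
apply: pursuit_arith; rewrite ?d20 ?mulr_ge0 ?l2norm_ge0 ?sqrtr_ge0 //.
rewrite (l2norm_restrC S D) offS l2normN lerD2r lerXn2r ?nnegrE ?l2norm_ge0 //.
by rewrite addr_ge0 ?mulr_ge0 ?sqrtr_ge0.
Qed.

End Pursuit.

(** * The golden ratio bound for hard thresholding *)

Section Thresholding.
Variable R : realType.

Definition golden : R := (Num.sqrt 5 + 1) / 2.

Lemma golden_sqr : golden ^+ 2 = golden + 1.
Proof.
have : Num.sqrt 5 ^+ 2 = 5 :> R by rewrite sqr_sqrtr.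
by rewrite /golden; move: (Num.sqrt _) => s ss; nra.
Qed.

Lemma golden_ge1 : 1 <= golden.
Proof.
have : 1 <= Num.sqrt 5 :> R by rewrite -[leLHS]sqrtr1 ler_wsqrtr // ler1n.
by rewrite /golden; lra.
Qed.

(** Summing [f i <= f j] over all pairs gives [#|V| * sum_U <= #|U| * sum_V], and [#|U| <= #|V|]
    finishes. *)
Lemma sum_dominated (T : finType) (U V : {set T}) (f : T -> R) :
  (#|U| <= #|V|)%N -> (forall i, 0 <= f i) ->
  {in U & V, forall i j, f i <= f j} ->
  \sum_(i in U) f i <= \sum_(i in V) f i.
Proof.
move=> UV f0 fUV; have [V0|V0] := posnP #|V|.
  move: UV; rewrite V0 leqn0 cards_eq0 => /eqP ->.
  by rewrite big_set0 sumr_ge0.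
have {}V0 : 0 < #|V|%:R :> R by rewrite ltr0n.
rewrite -(ler_pM2r V0) mulr_suml.
apply: (@le_trans _ _ (\sum_(i in U) \sum_(j in V) f j)).
  apply: ler_sum => i iU; rewrite mulr_natr -sumr_const.
  by apply: ler_sum => j jV; exact: fUV.
rewrite sumr_const -[leLHS]mulr_natr ler_wpM2l ?ler_nat //.
exact: sumr_ge0.
Qed.

(* The golden ratio enters as the larger root of [t^2 = t + 1]: it balances
   [(d + z)^2 <= t^2 d^2 + t z^2] against the energy [z^2] of the entries that
   thresholding keeps outside the support of [x]. *)
Lemma threshold_error n (r : nat) (z x : 'cV[R]_n) (T : {set 'I_n}) :
  #|T| = r -> (forall i j, i \in T -> j \notin T -> `|z j 0| <= `|z i 0|) ->
  sparse r x ->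
  l2norm (x - restr T z) <= golden * l2norm (restr (T :|: vsupp x) (x - z)).
Proof.
move=> Tr zT xr; have g1 := golden_ge1; have gg := golden_sqr.
have g0 : 0 <= golden by lra.
rewrite -ler_sqr ?nnegrE ?mulr_ge0 ?l2norm_ge0 // exprMn.
have swap : \sum_(i in vsupp x :\: T) z i 0 ^+ 2 <=
    \sum_(i in T :\: vsupp x) z i 0 ^+ 2.
  apply: sum_dominated => [|i|i j]; last 2 first.
  - exact: sqr_ge0.
  - rewrite !inE => /andP[iT _] /andP[_ jT].
    rewrite -(real_normK (num_real (z i 0))) -(real_normK (num_real (z j 0))).
    by rewrite lerXn2r ?nnegrE // zT.
  have := cardsID T (vsupp x); have := cardsID (vsupp x) T.
  by rewrite finset.setIC; rewrite /sparse in xr; lia.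
(* By [swap] the added term is nonpositive; with it the inequality holds coordinate by
   coordinate. *)
apply: (@le_trans _ _ (golden ^+ 2 * l2norm (restr (T :|: vsupp x) (x - z)) ^+ 2
    + golden * (\sum_(i in vsupp x :\: T) z i 0 ^+ 2
                - \sum_(i in T :\: vsupp x) z i 0 ^+ 2))); last by nra.
rewrite (l2norm_sqr (x - _)) l2norm_restr [\sum_(i in _ :|: _) _]big_mkcond.
rewrite [\sum_(i in _ :\: T) _]big_mkcond [\sum_(i in T :\: _) _]big_mkcond.
rewrite -sumrB !mulr_sumr -big_split; apply: ler_sum => i _ /=.
rewrite !mxE !finset.in_setU !finset.in_setD; have := vsuppPn x i.
case: (i \in T); case: (i \in vsupp x) => /= /elimT xi.
- by have := sqr_ge0 (x i 0 - z i 0); nra.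
- by rewrite xi //; nra.
(* A missed entry of [x]: multiplied by [golden], the gap between the two sides is exactly this
   square. *)
- have := sqr_ge0 (golden * (x i 0 - z i 0) - z i 0); nra.
- by rewrite xi //; nra.
Qed.

End Thresholding.

(** * Error analysis of one iteration *)

Section Step.
Variable R : realType.
Variables m n : nat.
Variables (A : 'M[R]_(m, n)) (y : 'cV[R]_m) (k q N : nat) (d1 d2 d3 : R).
Hypotheses (qk : (2 * k <= q)%N) (qn : (q <= n)%N) (N3 : (3 <= N)%N).
Hypothesis qN : (q + k <= N * k)%N.
Hypotheses (rip1 : rip_bound A k d1) (rip2 : rip_bound A (2 * k) d2).
Hypotheses (rip3 : rip_bound A (3 * k) d3) (d21 : d2 < 1).
Variables (x xs : 'cV[R]_n).
Hypotheses (xk : sparse k x) (xsk : sparse k xs).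

Let eta := y - A *m xs.
Let B := d3 * l2norm (x - xs) + Num.sqrt (1 + d1) * l2norm eta.

(** The target of [threshold_error] is [xs - x], which is [2 * k]-sparse, and [2 * k <= q]. The set
    left has at most [q + 2 * k <= N.+1 * k] elements, hence [N.+1] blocks, each bounded by [B]
    through [rip_grad]. *)
Lemma gradient_step_error h : hard_threshold q (A^T *m (y - A *m x)) h ->
  l2norm (xs - (x + h)) <= golden R * (Num.sqrt N.+1%:R * B).
Proof.
case=> T [Tq Tmax hT].
have d30 : 0 <= d3 by case: rip3.
have B0 : 0 <= B by rewrite addr_ge0 ?mulr_ge0 ?l2norm_ge0 ?sqrtr_ge0.
have vk : sparse (2 * k) (xs - x).
  apply: (sparse_sub (vsuppD _ _)); rewrite vsuppN.
  by apply: leq_trans (leq_card_setU _ _) _; move: xk xsk; rewrite /sparse; lia.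
have -> : xs - (x + h) = (xs - x) - restr T (A^T *m (y - A *m x)).
  by rewrite hT opprD addrA.
apply: le_trans (threshold_error Tq Tmax (leq_trans vk qk)) _.
rewrite ler_wpM2l //; first by have := golden_ge1 R; lra.
rewrite -ler_sqr ?nnegrE ?mulr_ge0 ?l2norm_ge0 ?sqrtr_ge0 // exprMn.
rewrite (@sqr_sqrtr _ N.+1%:R) //.
apply: (l2norm_blocks (k := k)) => // [V Vk|]; last first.
  by apply: leq_trans (leq_card_setU _ _) _; rewrite /sparse in vk; lia.
have -> : y - A *m x = A *m (xs - x) + eta.
  by rewrite mulmxBr [RHS]addrC /eta addrA subrK.
by rewrite /B -(l2normN (x - xs)) opprB; apply: rip_grad rip1 rip3 vk Vk.
Qed.

(** The set [W] has at most [2 * k] elements, so the lower RIP bound applies on it. There the image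
    is that of [xs - z], controlled by optimality of [w], minus that of the part outside [W],
    controlled by blocks. *)
Lemma relaxed_thresholding_error (u w : 'cV[R]_n) (T : {set 'I_n}) :
  sparse (q + k) u -> (#|T| <= k)%N ->
  is_argmin
    (fun w : 'cV[R]_n => \sum_i w i 0 = k%:R /\ forall i, 0 <= w i 0 <= 1)
    (fun w => l2norm (y - A *m hadamard w u) ^+ 2) w ->
  Num.sqrt (1 - d2) *
    l2norm (restr (T :|: vsupp xs) (xs - hadamard w u)) <=
  Num.sqrt (1 + d1) * ((1 + Num.sqrt N%:R) * l2norm (xs - u)) + 2 * l2norm eta.
Proof.
move=> uqk Tk [[_ w01] wmin]; set W := T :|: vsupp xs; set z := hadamard w u.
have Wk : (#|W| <= 2 * k)%N.
  by apply: leq_trans (leq_card_setU _ _) _; move: xsk; rewrite /sparse; lia.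
(* Exactly [k] elements are required for the indicator of [S] to meet the constraint that the
   weights sum to [k]. *)
have [S xsS Sk] : exists2 S : {set 'I_n}, vsupp xs \subset S & #|S| = k.
  by apply: superset_of_card; rewrite card_ord; move: xsk; rewrite /sparse; lia.
have opt : l2norm (y - A *m z) <= l2norm (y - A *m restr S u).
  have -> : restr S u = hadamard (restr S (const_mx 1)) u.
    by apply/colP => i; rewrite !mxE; case: ifP; rewrite ?mul1r ?mul0r.
  rewrite -ler_sqr ?nnegrE ?l2norm_ge0 //; apply: wmin; split.
    rewrite -Sk -sumr_const [RHS]big_mkcond; apply: eq_bigr => i _.
    by rewrite !mxE.
  by move=> i; rewrite !mxE; case: ifP; rewrite ?lexx ?ler01.
(* One [eta] comes from passing between [xs] and [y] for [z], the other from doing the same for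
   [restr S u]. *)
have upper : l2norm (A *m (xs - z)) <=
    Num.sqrt (1 + d1) * l2norm (xs - u) + 2 * l2norm eta.
  have -> : A *m (xs - z) = (y - A *m z) + - eta.
    by rewrite mulmxBr /eta opprB [RHS]addrC addrA subrK.
  apply: le_trans (l2normD _ _) _; rewrite l2normN.
  suff : l2norm (y - A *m restr S u) <=
      Num.sqrt (1 + d1) * l2norm (xs - u) + l2norm eta by lra.
  have -> : y - A *m restr S u = A *m restr S (xs - u) + eta.
    rewrite restrD restrN (restr_id xsS) mulmxDr mulmxN /eta.
    by rewrite [RHS]addrC addrA subrK.
  apply: le_trans (l2normD _ _) _; rewrite lerD2r.
  apply: le_trans (rip_ub rip1 (sparse_sub (vsupp_restr _ _) _)) _.
    by rewrite Sk.
  by rewrite ler_wpM2l ?sqrtr_ge0 // l2norm_restr_le.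
(* Outside [W] the vector [xs] vanishes and the weights lie in [0, 1], so the entries of [z] are
   dominated by those of [xs - u]. *)
have tail : l2norm (A *m restr (~: W) (xs - z)) <=
    Num.sqrt (1 + d1) * (Num.sqrt N%:R * l2norm (xs - u)).
  have d10 : 0 <= 1 + d1 by case: rip1 => d10 _; rewrite addr_ge0.
  rewrite -ler_sqr ?nnegrE ?mulr_ge0 ?l2norm_ge0 ?sqrtr_ge0 // !exprMn.
  rewrite (@sqr_sqrtr _ (1 + d1)) // (@sqr_sqrtr _ N%:R) // mulrCA mulrA.
  set t := restr _ _.
  have tE i : t i 0 = if i \in W then 0 else - (w i 0 * u i 0).
    rewrite !mxE finset.in_setC; case: (boolP (i \in W)) => //=.
    by rewrite inE negb_or => /andP[_ /vsuppPn ->]; rewrite sub0r.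
  have tk : sparse (N * k) t.
    apply: leq_trans qN; apply: sparseS uqk; apply/vsupp_subP => i.
    by move=> /vsuppPn ui; rewrite tE ui mulr0 oppr0; case: ifP.
  apply: le_trans (rip_ub_blocks rip1 tk) _.
  rewrite ler_wpM2l ?mulr_ge0 // lerXn2r ?nnegrE ?l2norm_ge0 //.
  apply: ler_l2norm => i; rewrite tE; case: ifPn; first by rewrite normr0.
  rewrite inE negb_or => /andP[_ /vsuppPn xsi]; rewrite !mxE xsi sub0r !normrN.
  have /andP[w0 w1] := w01 i.
  by rewrite normrM ger0_norm // ler_piMl.
have := rip_lb (ltW d21) rip2 (sparse_sub (vsupp_restr W (xs - z)) Wk).
have -> : A *m restr W (xs - z) = A *m (xs - z) + - (A *m restr (~: W) (xs - z)).
  by rewrite -{2}(restr_addC W (xs - z)) mulmxDr addrK.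
have := l2normD (A *m (xs - z)) (- (A *m restr (~: W) (xs - z))).
by rewrite l2normN; lra.
Qed.

(** As [N] is at least 3, [sqrt (N + 1) <= N]; AM-GM bounds the product of the two roots by
    [N + 1/2]. *)
Lemma block_count_arith : (1 + Num.sqrt N%:R) * Num.sqrt N.+1%:R <= 3 * N%:R :> R.
Proof.
have N0 : 3 <= N%:R :> R by rewrite (ler_nat _ 3).
have := sqr_sqrtr (ler0n R N); have := sqr_sqrtr (ler0n R N.+1).
have := sqrtr_ge0 (N%:R : R); have := sqrtr_ge0 (N.+1%:R : R).
rewrite -[N.+1%:R]natr1; move: (N%:R) N0 (Num.sqrt N%:R) (Num.sqrt (N%:R + 1)).
move=> M M3 a b b0 a0 bb aa.
have : b <= M by rewrite -ler_sqr ?nnegrE; nra.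
have := sqr_ge0 (a - b); nra.
Qed.

(** Chains the estimates of one iteration: [E] stands for the error of [u], [X] for that of
    [hadamard w u] on the relevant set, [Y] for the part of [xs] missed by the new support, and [a],
    [b] for [sqrt N] and [sqrt (N + 1)]. *)
Lemma step_arith (s r a b M C g e E X Y : R) :
  0 <= s -> 0 <= r -> 0 <= a -> 0 <= g -> 0 <= C ->
  (1 + a) * b <= 3 * M -> E <= g * (b * C) ->
  s * X <= r * ((1 + a) * E) + 2 * e -> Y <= g * X ->
  Y * s <= g * (3 * g * M * r * C + 2 * e).
Proof.
move=> s0 r0 a0 g0 C0 abM EC sX YX.
apply: (@le_trans _ _ (g * (s * X))); first by rewrite mulrCA mulrC ler_wpM2l.
rewrite ler_wpM2l // (le_trans sX) // lerD2r.
rewrite (_ : 3 * g * M * r * C = r * (3 * M * (g * C))); last by ring.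
rewrite ler_wpM2l //; apply: (@le_trans _ _ ((1 + a) * (g * (b * C)))).
  by rewrite ler_wpM2l // addr_ge0.
rewrite (_ : _ * _ = (1 + a) * b * (g * C)); last by ring.
by rewrite ler_wpM2r // mulr_ge0.
Qed.

Lemma pgrotp_step_error x' : pgrotp_step A y k q x x' ->
  l2norm (x' - xs) <=
    golden R * (3 * golden R * N%:R * Num.sqrt (1 + d1) * B + 2 * l2norm eta)
      / (Num.sqrt (1 - d2) * Num.sqrt (1 - d2 ^+ 2))
    + Num.sqrt (1 + d1) * l2norm eta / (1 - d2).
Proof.
case=> h [u [w [S [hq uE wmin [z [T [Tk Tmax zE] SE]] x'min]]]].
have d20 : 0 <= d2 by case: rip2.
have d30 : 0 <= d3 by case: rip3.
have g1 := golden_ge1 R.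
have B0 : 0 <= B by rewrite addr_ge0 ?mulr_ge0 ?l2norm_ge0 ?sqrtr_ge0.
have Sk : (#|S| <= k)%N by rewrite -Tk SE zE subset_leq_card ?vsupp_restr.
apply: le_trans (pursuit_error rip1 rip2 d21 xsk Sk x'min) _.
rewrite lerD2r.
have s1 : 0 < Num.sqrt (1 - d2) by rewrite sqrtr_gt0 subr_gt0.
have s2 : 0 < Num.sqrt (1 - d2 ^+ 2) by rewrite sqrtr_gt0 subr_gt0 expr_lt1.
rewrite invfM mulrA ler_pM2r ?invr_gt0 // ler_pdivlMr //.
have uqk : sparse (q + k) u.
  rewrite uE; apply: (sparse_sub (vsuppD _ _)).
  apply: leq_trans (leq_card_setU _ _) _; rewrite addnC leq_add //.
  by case: hq => T' [<- _ ->]; rewrite subset_leq_card ?vsupp_restr.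
have sX := relaxed_thresholding_error uqk (eq_leq Tk) wmin.
have EB := gradient_step_error hq; rewrite -uE in EB.
(* Since [S] is the support of [z], subtracting [z] changes nothing off [S]. *)
have off : l2norm (restr (~: S) xs) <= l2norm (xs - restr T (hadamard w u)).
  have zS : restr (~: S) z = 0.
    by apply/colP => i; rewrite !mxE SE !inE negbK; case: eqP.
  rewrite -[restr _ xs]subr0 -zS -(restrN (~: S)) -restrD zE.
  exact: l2norm_restr_le.
have XE := le_trans off (threshold_error Tk Tmax xsk).
apply: (step_arith _ _ _ _ _ block_count_arith EB sX XE) => //; exact: le_trans ler01 g1.
Qed.

Lemma pgrotp_step_sparse x' : pgrotp_step A y k q x x' -> sparse k x'.
Proof.
case=> h [u [w [S [_ _ _ [z [T [Tk _ zE] SE]] [x'S _]]]]].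
apply: (sparse_sub x'S); rewrite -Tk SE zE subset_leq_card //.
exact: vsupp_restr.
Qed.

Hypotheses (d12 : d1 <= d2) (d23 : d2 <= d3) (d31 : d3 < 1).

(** Puts the bound of [pgrotp_step_error] into the form of the theorem: [d1 <= d2] removes a ratio
    of square roots from the contraction factor, and [d2 <= d3] replaces [1 - d2] by [1 - d3]. *)
Lemma pgrotp_step_contraction x' : pgrotp_step A y k q x x' ->
  l2norm (x' - xs) <=
    golden R ^+ 2 * (3 * N%:R * d3 / (1 - d3)) * l2norm (x - xs) +
    ((3 * golden R ^+ 2 * N%:R * (1 + d1) + Num.sqrt 5 + 1)
       / ((1 - d2) * Num.sqrt (1 + d2))
     + Num.sqrt (1 + d1) / (1 - d2)) * l2norm eta.
Proof.
move=> /pgrotp_step_error /le_trans; apply.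
have d10 : 0 <= d1 by case: rip1.
have d20 : 0 <= d2 by case: rip2.
have d2lt : 0 < 1 - d2 by rewrite subr_gt0.
have d3lt : 0 < 1 - d3 by rewrite subr_gt0.
have -> : 1 - d2 ^+ 2 = (1 - d2) * (1 + d2) by ring.
rewrite sqrtrM ?(ltW d2lt) // mulrA -expr2 sqr_sqrtr ?(ltW d2lt) //.
have t0 : 0 < Num.sqrt (1 + d2) by rewrite sqrtr_gt0; lra.
have rt : Num.sqrt (1 + d1) <= Num.sqrt (1 + d2) by rewrite ler_wsqrtr // lerD2l.
have rr : Num.sqrt (1 + d1) ^+ 2 = 1 + d1 by rewrite sqr_sqrtr // addr_ge0.
(* Here [sqrt 5 + 1] is twice the golden ratio. *)
have -> : 3 * golden R ^+ 2 * N%:R * (1 + d1) + Num.sqrt 5 + 1 =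
    3 * golden R ^+ 2 * N%:R * Num.sqrt (1 + d1) ^+ 2 + 2 * golden R.
  by rewrite rr /golden; field.
have V0 := l2norm_ge0 (x - xs); rewrite /B.
have g0 := le_trans ler01 (golden_ge1 R).
have r0 := sqrtr_ge0 (1 + d1).
move: (Num.sqrt (1 + d2)) (Num.sqrt (1 + d1)) t0 r0 rt {rr} => t r t0 r0 rt.
have d2n : 1 - d2 != 0 by rewrite gt_eqF.
have tn : t != 0 by rewrite gt_eqF.
rewrite [leLHS](_ : _ =
  golden R ^+ 2 * (3 * N%:R * d3 * (r / t / (1 - d2))) * l2norm (x - xs)
  + ((3 * golden R ^+ 2 * N%:R * r ^+ 2 + 2 * golden R) / ((1 - d2) * t)
     + r / (1 - d2)) * l2norm eta); last by field; rewrite d2n tn.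
have d30 : 0 <= d3 by case: rip3.
rewrite lerD2r ler_wpM2r // ler_wpM2l ?sqr_ge0 // ler_wpM2l ?mulr_ge0 //.
apply: (@le_trans _ _ (1 - d2)^-1).
  by rewrite ler_piMl ?invr_ge0 ?(ltW d2lt) // ler_pdivrMr // mul1r.
by rewrite lef_pV2 ?posrE // lerD2l lerN2.
Qed.

End Step.

(** * From one iteration to the whole sequence *)

Lemma affine_recursion (R : realType) (a : nat -> R) (r t : R) :
  0 <= r < 1 -> (forall p, a p.+1 <= r * a p + t) ->
  0 <= t -> forall p, a p <= r ^+ p * a 0%N + t / (1 - r).
Proof.
move=> /andP[r0 r1] step t0; have r1' : 0 < 1 - r by rewrite subr_gt0.
elim=> [|p IHp]; first by rewrite expr0 mul1r lerDl divr_ge0 // ltW.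
apply: le_trans (step p) _.
apply: (@le_trans _ _ (r * (r ^+ p * a 0%N + t / (1 - r)) + t)).
  by rewrite lerD2r ler_wpM2l.
(* An equality, because [t / (1 - r)] is the fixed point of the map sending [s] to [r * s + t]. *)
by rewrite exprS le_eqVlt; apply/orP; left; apply/eqP; field; rewrite gt_eqF.
Qed.

(** Convergence of matrices is entrywise uniform here, and each entry is bounded by the Euclidean
    norm. *)
Lemma l2norm_cvg (R : realType) n (x : nat -> 'cV[R]_n) (xs : 'cV[R]_n) (r a : R) :
  0 <= r < 1 -> (forall p, l2norm (x p - xs) <= r ^+ p * a) -> x @ \oo --> xs.
Proof.
move=> /andP[r0 r1] xr; apply/cvg_ballP => e e0.
have : geometric a r @ \oo --> (0 : R) by apply: cvg_geometric; rewrite ger0_norm.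
move=> /cvgrPdist_lt /(_ e e0) [M _ HM]; exists M => // p Mp; split=> // i j.
rewrite (ord1 j) -ball_normE /= distrC.
have := l2norm_coord (x p - xs) i; rewrite !mxE => /le_lt_trans; apply.
apply: le_lt_trans (xr p) _; have := HM p Mp.
by rewrite /= sub0r normrN mulrC; apply: le_lt_trans; exact: ler_norm.
Qed.

(** Turns the integer ceiling into a natural number of blocks: [q / k] is at most its ceiling, and
    the extra 1 pays for [k]. *)
Lemma ceil_block_count (R : realType) (k q : nat) : (0 < k)%N ->
  exists2 N : nat, (Num.ceil (q%:R / k%:R : R))%:~R + 1 = N%:R :> R
    & (q + k <= N * k)%N.
Proof.
move=> k0; have k0R : 0 < k%:R :> R by rewrite ltr0n.
set x : R := q%:R / k%:R; have x0 : 0 <= x by rewrite divr_ge0.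
have c0 : 0 <= Num.ceil x by rewrite Num.Theory.ceil_ge0 (lt_le_trans _ x0) // ltrN10.
exists (`|Num.ceil x|%N.+1).
  by rewrite -natr1 -[in LHS](gez0_abs c0) pmulrn.
rewrite mulSn addnC leq_add2l -(ler_nat R) natrM -ler_pdivrMr //.
by rewrite -/x [leRHS]pmulrn (gez0_abs c0) Num.Theory.ceil_ge.
Qed.

Theorem theorem4 (R : realType) (m n : nat) (A : 'M[R]_(m, n)) (y : 'cV[R]_m)
    (k q : nat) (hk : (1 <= k)%N) (hkq : (2 * k <= q)%N) (hqn : (q <= n)%N)
    (xs : 'cV[R]_n)
    (hxs : is_argmin (fun x : 'cV[R]_n => sparse k x)
             (fun x => 1 / 2 * l2norm (y - A *m x) ^+ 2) xs) :
  let eta := y - A *m xs in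
  let delta := ric A in
  let phi : R := (Num.sqrt 5 + 1) / 2 in
  let c : R := (Num.ceil (q%:R / k%:R : R))%:~R + 1 in
  let rho := phi ^+ 2 * (3 * c * delta (3 * k)%N / (1 - delta (3 * k)%N)) in
  let tau :=
    (3 * phi ^+ 2 * c * (1 + delta k) + Num.sqrt 5 + 1)
      / ((1 - delta (2 * k)%N) * Num.sqrt (1 + delta (2 * k)%N))
    + Num.sqrt (1 + delta k) / (1 - delta (2 * k)%N) in
  delta (3 * k)%N < 1 / (3 * phi ^+ 2 * c + 1) ->
  rho < 1 /\
  forall x : nat -> 'cV[R]_n, pgrotp A y k q x ->
    (forall p : nat,
       l2norm (x p.+1 - xs)
         <= rho ^+ p * l2norm (x 0%N - xs) + tau / (1 - rho) * l2norm eta)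
    /\ (eta = 0 -> x @ \oo --> xs).
Proof.
move=> eta delta phi c rho tau small.
have [N cN qN] := ceil_block_count R q hk; rewrite -/c in cN.
(* From [2 * k <= q] one gets [3 * k <= q + k <= N * k]. *)
have N3 : (3 <= N)%N.
  rewrite -(leq_pmul2r hk); apply: leq_trans qN.
  by rewrite mulSnr leq_add2r.
have rip s : rip_bound A s (delta s) := rip_ric A s.
have delta0 s : 0 <= delta s by case: (rip s).
have d12 : delta k <= delta (2 * k)%N by apply: ric_le; rewrite leq_pmull.
have d23 : delta (2 * k)%N <= delta (3 * k)%N by apply: ric_le; rewrite leq_mul2r orbT.
have K0 : 0 <= 3 * phi ^+ 2 * c by rewrite cN !mulr_ge0 ?sqr_ge0.
have {small} small : delta (3 * k)%N * (3 * phi ^+ 2 * c + 1) < 1.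
  by rewrite -ltr_pdivlMr //; lra.
have d31 : delta (3 * k)%N < 1.
  apply: le_lt_trans small; rewrite ler_peMr //; lra.
have d3lt : 0 < 1 - delta (3 * k)%N by rewrite subr_gt0.
have rhoE : rho = delta (3 * k)%N * (3 * phi ^+ 2 * c) / (1 - delta (3 * k)%N).
  have E (a b d : R) : a ^+ 2 * (3 * b * d) = d * (3 * a ^+ 2 * b) by ring.
  by rewrite -E -mulrA.
have rho0 : 0 <= rho by rewrite rhoE; apply: divr_ge0; [exact: mulr_ge0 | exact: ltW].
(* Clearing the denominator turns this into [small]. *)
have rho1 : rho < 1 by rewrite rhoE ltr_pdivrMr // mul1r; nra.
have d21 : delta (2 * k)%N < 1 by exact: le_lt_trans d31.
have tau0 : 0 <= tau.
  have d2lt : 0 <= 1 - delta (2 * k)%N by rewrite subr_ge0 ltW.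
  rewrite /tau addr_ge0 // divr_ge0 ?mulr_ge0 ?sqrtr_ge0 //.
  by rewrite !addr_ge0 ?sqrtr_ge0 // mulr_ge0 // addr_ge0.
split=> // x [x0 xstep].
have xk p : sparse k (x p).
  elim: p => [|p IHp]; last exact: pgrotp_step_sparse (xstep p).
  rewrite x0 /sparse (_ : vsupp 0 = finset.set0) ?cards0 //.
  by apply/setP => i; rewrite !inE mxE eqxx.
have bound p : l2norm (x p - xs) <=
    rho ^+ p * l2norm (x 0%N - xs) + tau * l2norm eta / (1 - rho).
  apply: (@affine_recursion _ (fun p => l2norm (x p - xs))) => [|{}p|].
  - by rewrite rho0.
  - rewrite /rho /tau cN.
    apply: pgrotp_step_contraction (xstep p) => //; exact: hxs.1.
  - by rewrite mulr_ge0 ?l2norm_ge0.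
split=> [p|eta0].
  (* The recursion yields [rho ^+ p.+1], which is weakened to the stated [rho ^+ p]. *)
  apply: le_trans (bound p.+1) _; rewrite mulrAC lerD2r ler_wpM2r ?l2norm_ge0 //.
  by rewrite exprS ler_piMl ?exprn_ge0 // ltW.
apply: (@l2norm_cvg _ _ _ _ rho (l2norm (x 0%N - xs))) => [|p]; first by rewrite rho0.
by have := bound p; rewrite eta0 l2norm0 mulr0 mul0r addr0.
Qed.
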